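(* Let $\lambda>1$, let $N\ge 1$ be an integer and let $0<p<1$. Let $MD_p:\mathbb{R}^2\to\mathbb{R}$ be the discrete Lagrangian descriptor, as a function of the initial condition $(x_0,y_0)$, of the linear area-preserving map $x_{n+1}=\lambda x_n$, $y_{n+1}=\frac{1}{\lambda}y_n$ (defined in the context). Then: (1) For every $\bar{x}\in\mathbb{R}$, the derivative of $MD_p$ along the vertical line $\{x=\bar{x}\}$ (which is perpendicular to the unstable manifold $\{y=0\}$ of the origin) becomes unbounded on the unstable manifold, i.e. $\left|\frac{\partial MD_p}{\partial y}(\bar{x},y)\right|\to\infty$ as $y\to 0$, $y\neq 0$. (2) For every $\bar{y}\in\mathbb{R}$, the derivative of $MD_p$ along the horizontal line $\{y=\bar{y}\}$ (which is perpendicular to the stable manifold $\{x=0\}$ of the origin) becomes unbounded on the stable manifold, i.e. $\left|\frac{\partial MD_p}{\partial x}(x,\bar{y})\right|\to\infty$ as $x\to 0$, $x\neq 0$.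
   Context: For an initial condition $(x_0,y_0)\in\mathbb{R}^2$, let $\{(x_n,y_n)\}_{n=-N}^{N}$ be the orbit segment through $(x_0,y_0)$ of the invertible map $(x,y)\mapsto(\lambda x,\lambda^{-1}y)$, i.e. $x_n=\lambda^n x_0$ and $y_n=\lambda^{-n}y_0$ for $-N\le n\le N$. For $p\le 1$ the discrete Lagrangian descriptor is $$MD_p(x_0,y_0)=\sum_{i=-N}^{N-1}\left(|x_{i+1}-x_i|^p+|y_{i+1}-y_i|^p\right).$$ The origin is a hyperbolic saddle fixed point whose stable manifold is the line $\{x=0\}$ and whose unstable manifold is the line $\{y=0\}$. *)

(* Defs.v *)
From HB Require Import structures.
From mathcomp Require Import all_boot all_order all_algebra.
From mathcomp Require Import all_classical all_reals all_analysis.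

Set Implicit Arguments.
Unset Strict Implicit.
Unset Printing Implicit Defensive.

Import Order.TTheory GRing.Theory Num.Theory.
Import numFieldNormedType.Exports.

Local Open Scope classical_set_scope.
Local Open Scope ring_scope.

Definition saddle_map (R : realType) (lambda : R) (z : R * R) : R * R :=
  (lambda * z.1, lambda^-1 * z.2).

Definition saddle_orbit (R : realType) (lambda : R) (z : R * R) (n : int) :
    R * R :=
  (lambda ^ n * z.1, lambda ^ (- n) * z.2).

Lemma saddle_orbit0 (R : realType) (lambda : R) (z : R * R) :
  saddle_orbit lambda z 0 = z.
Proof. by case: z => x y; rewrite /saddle_orbit oppr0 expr0z !mul1r. Qed.

Lemma saddle_orbitS (R : realType) (lambda : R) (z : R * R) (n : int) :
  lambda != 0 ->
  saddle_orbit lambda z (n + 1) = saddle_map lambda (saddle_orbit lambda z n).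
Proof.
move=> l0; rewrite /saddle_orbit /saddle_map /= opprD addrC [X in lambda ^ X]addrC.
by rewrite !expfzDr// expr1z exprN1 [lambda ^ n * lambda]mulrC !mulrA
  [lambda^-1 * _]mulrC.
Qed.

(* The index i = k - N runs over -N, ..., N - 1.  For p <> 0 the library's
   real power satisfies 0 `^ p = 0. *)
Definition MD (R : realType) (lambda : R) (N : nat) (p : R) (z : R * R) : R :=
  \sum_(0 <= k < N.*2)
    let i : int := k%:Z - N%:Z in
    let u := saddle_orbit lambda z i in
    let v := saddle_orbit lambda z (i + 1) in
    (`|v.1 - u.1| `^ p + `|v.2 - u.2| `^ p).

(* Main.v *)
Require Import Defs.
From mathcomp Require Import all_boot all_order all_algebra.
From mathcomp Require Import all_classical all_reals all_analysis.

Import Order.TTheory GRing.Theory Num.Theory.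
Import numFieldNormedType.Exports.

Local Open Scope classical_set_scope.
Local Open Scope ring_scope.

(** Each increment of the orbit is linear in the initial condition, so that
    [MD lambda N p (x, y) = A * |x| ^ p + B * |y| ^ p] for two constants
    [A, B > 0].  Off the axis, the partial derivatives therefore have absolute
    values [A * p * |x| ^ (p - 1)] and [B * p * |y| ^ (p - 1)], which blow up
    at [0] because [p < 1]. *)

(** The sign [s] of [y] is locally constant, so near [y] the function is [(s * t) ^ p] with
    [s * t > 0], and the chain rule applies. *)
Lemma is_derive_norm_powR (R : realType) (p y : R) : y != 0 ->
  is_derive y 1 (fun t : R => `|t| `^ p) (Num.sg y * (p * `|y| `^ (p - 1))).
Proof.
move=> y0; set s := Num.sg y.
have sy : 0 < s * y by rewrite -normrEsg normr_gt0.
have near_norm : \forall t \near y, (s * t) `^ p = `|t| `^ p.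
  have st_gt0 : \forall t \near y, 0 < s * t.
    have : s * t @[t --> y] --> s * y by exact: mulrl_continuous.
    by move=> /cvgr_gt; apply.
  near=> t; congr (_ `^ p).
  have st : 0 < s * t by near: t.
  by rewrite -(gtr0_norm st) normrM normr_sg y0 mul1r.
apply: (near_eq_is_derive near_norm).
have -> : `|y| = s * y by rewrite -normrEsg.
rewrite [X in is_derive _ _ _ X]mulrC.
apply: (@is_derive1_comp _ (fun u : R => u `^ p) (fun t => s * t)).
- exact: is_derive1_powR.
- have := @is_deriveZ _ _ _ id s y 1 1 (is_derive_id _ _).
  by rewrite [s *: 1]mulr1.
Unshelve. all: by end_near. Qed.

Lemma cvg_norm_powR_pinfty (R : realType) (c q : R) : 0 < c -> q < 0 ->
  c * `|y| `^ q @[y --> (0 : R)^'] --> +oo.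
Proof.
move=> c0 q0; apply/cvgryPge => A.
(* Replacing the bound [A] by a positive one lets real powers of [M / c] be taken and inverted. *)
pose M := Num.max A 1.
have M0 : 0 < M by rewrite lt_max ltr01 orbT.
have cM0 : 0 < M / c by rewrite divr_gt0.
near=> y.
have y0 : 0 < `|y|.
  by rewrite normr_gt0; near: y; exact: nbhs_dnbhs_neq.
(* This radius solves [c * r ^ q = M]. Raising to the positive power [- q] preserves the inequality,
   and taking inverses then reverses it. *)
have yle : `|y| <= (M / c) `^ q^-1.
  by near: y; apply: dnbhs0_le; exact: powR_gt0.
have : M / c <= `|y| `^ q.
  have := @ge0_ler_powR _ (- q) _ _ _ _ _ yle.
  rewrite oppr_ge0 (ltW q0) !nnegrE !powR_ge0 (ltW y0) => /(_ isT isT isT).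
  rewrite -powRrM mulrN mulVf ?lt_eqF// powR_inv1 ?(ltW cM0)// powRN.
  by rewrite lef_pV2 ?posrE ?powR_gt0.
rewrite ler_pdivrMr// mulrC; apply: le_trans.
by rewrite le_max lexx.
Unshelve. all: by end_near. Qed.

Lemma norm_powR_blowup {R : realType} {c p : R} (K : R) {f : R -> R} :
  0 < c -> 0 < p -> p < 1 -> (forall t, f t = c * `|t| `^ p + K) ->
  (forall y, y != 0 -> derivable f y 1) /\
  `| derive1 f y | @[y --> (0 : R)^'] --> +oo.
Proof.
move=> c0 p0 p1 /funext ->.
have df (y : R) : y != 0 -> is_derive y 1 (fun t : R => c * `|t| `^ p + K)
    (c * (Num.sg y * (p * `|y| `^ (p - 1)))).
  move=> y0; rewrite -[X in is_derive _ _ _ X]addr0.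
  apply: is_deriveD.
  apply: (@is_deriveZ _ _ _ (fun t : R => `|t| `^ p)).
  exact: is_derive_norm_powR.
split=> [y /df[]//|].
have p1_lt0 : p - 1 < 0 by rewrite subr_lt0.
apply: cvg_trans (@cvg_norm_powR_pinfty R (c * p) (p - 1) (mulr_gt0 c0 p0) p1_lt0).
apply: near_eq_cvg; near=> y.
have y0 : y != 0 by near: y; exact: nbhs_dnbhs_neq.
have [_] := df _ y0; rewrite derive1E => ->.
rewrite !normrM normr_sg y0 mul1r (gtr0_norm c0) (gtr0_norm p0).
by rewrite (ger0_norm (powR_ge0 _ _)) mulrA.
Unshelve. all: by end_near. Qed.

(** These are the coefficients [A] and [B]. Keeping [w] abstract treats the expanding and
    contracting directions together. *)
Definition increment_weight {R : realType} (N : nat) (p : R) (w : int -> R) : R :=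
  \sum_(0 <= k < N.*2) `|w (k%:Z - N%:Z + 1) - w (k%:Z - N%:Z)| `^ p.

Lemma increment_weight_gt0 (R : realType) (N : nat) (p : R) (w : int -> R) :
  (0 < N)%N -> injective w -> 0 < increment_weight N p w.
Proof.
(* One positive term suffices: the first increment exists since [0 < N], and it is nonzero by
   injectivity of [w]. *)
move=> N0 w_inj; rewrite /increment_weight big_ltn ?double_gt0//.
apply: ltr_wpDr; first by apply: sumr_ge0 => k _; exact: powR_ge0.
apply: powR_gt0; rewrite normr_gt0 subr_eq0 (inj_eq w_inj).
by rewrite -[eqbRHS]addr0 (inj_eq (addrI _)).
Qed.

Lemma MD_weights (R : realType) (lambda : R) (N : nat) (p x y : R) :
  MD lambda N p (x, y) =
    increment_weight N p (exprz lambda) * `|x| `^ p +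
    increment_weight N p (fun n => lambda ^ (- n)) * `|y| `^ p.
Proof.
rewrite /MD /increment_weight !mulr_suml -big_split; apply: eq_bigr => k _ /=.
by rewrite -!mulrBl !normrM !powRM.
Qed.

Theorem theorem1 (R : realType) (lambda : R) (N : nat) (p : R)
    (hlambda : 1 < lambda) (hN : (1 <= N)%N) (hp0 : 0 < p) (hp1 : p < 1) :
  (forall xbar : R,
     (forall y : R, y != 0 ->
        derivable (fun t : R => MD lambda N p (xbar, t)) y 1) /\
     `| derive1 (fun t : R => MD lambda N p (xbar, t)) y | @[y --> (0 : R)^']
       --> +oo) /\
  (forall ybar : R,
     (forall x : R, x != 0 ->
        derivable (fun t : R => MD lambda N p (t, ybar)) x 1) /\
     `| derive1 (fun t : R => MD lambda N p (t, ybar)) x | @[x --> (0 : R)^']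
       --> +oo).
Proof.
(* Here [1 < lambda] enters: distinct powers of [lambda] differ, so both weights are positive. *)
have l_inj : injective (exprz lambda).
  by apply: ieexprIz; [exact: lt_trans hlambda | rewrite gt_eqF].
split=> z.
- apply: norm_powR_blowup hp0 hp1 _; last first.
    by move=> t; rewrite MD_weights addrC.
  by apply: increment_weight_gt0 => // m n /l_inj /oppr_inj.
- apply: norm_powR_blowup hp0 hp1 _; last by move=> t; rewrite MD_weights.
  exact: increment_weight_gt0.
Qed.
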